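(* Let $k\ge1$, let $\mathbb{F}_p$ be a finite field of characteristic $p>2k+2$, and let $Pdx+Qdy$ be a differential form of degree $d$ over $\mathbb{Z}$. Let $s_{k,\mathbb{F}_p}(\bar P,\bar Q)$ be the result of Frommer's algorithm over $\mathbb{F}_p$ applied to the reduction $\bar Pdx+\bar Qdy$ of $Pdx+Qdy$ to $\mathbb{F}_p$, and let $s_{k,\mathbb{Q}}(P,Q)$ be the result of Frommer's algorithm over $\mathbb{Q}$ applied to $Pdx+Qdy$. Then $$s_{k,\mathbb{F}_p}(\bar P,\bar Q)=0\iff\overline{\delta_k\,s_{k,\mathbb{Q}}(P,Q)}=0,$$ where $\delta_k$ is the smallest common denominator of all coefficients of the focal polynomial $s_{k,\mathbb{Q}}\in\mathbb{Q}[p_{ij},q_{ij}]$ and the bar denotes reduction modulo $p$.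
   Context: A differential form $Pdx+Qdy$ of degree $d$ over a commutative ring $K$ is a pair $P=\sum_{i+j\le d}p_{ij}x^iy^jz^{d-i-j}$, $Q=\sum_{i+j\le d}q_{ij}x^iy^jz^{d-i-j}$ with $p_{ij},q_{ij}\in K$; put $p_{ij}=q_{ij}=0$ if $i+j>d$. (The forms of interest are the Poincar\'e forms, those with $p_{00}=q_{00}=0$, $p_{10}=q_{01}=1$, $p_{01}=q_{10}=0$; the formulas below only use coefficients with $i+j\ge2$.) Frommer's algorithm over $K$, computing the $k$-th focal value $s_k(P,Q)$: start with $a_{2,0}=a_{0,2}=1$, $a_{0,0}=a_{0,1}=a_{1,0}=a_{1,1}=0$, and $a_{i,j}=c_{i,j}=0$ if $i<0$ or $j<0$. For $n=3,4,\dots,2k+2$ compute, for $0\le l\le n$, $$c_{l,n-l}=\sum_{2\le i+j\le n}\bigl(-(n-l-j+1)p_{ij}a_{l-i,n-l-j+1}+(l-i+1)q_{ij}a_{l-i+1,n-l-j}\bigr)$$ and then $a_{n-l,l}$ as follows, where $\alpha(i,n)=\prod_{h=1}^{i}\frac{n-(2h-1)}{2h-1}$ and empty products are $1$: - $l,n$ even, $l<n$: $a_{n-l,l}=-\sum_{i=1}^{(n-l)/2}\frac{c_{2i-1,n-(2i-1)}}{n-l}\prod_{j=i}^{(n-l-2)/2}\frac{n-2j}{2j}$; - $l=n$ even: $a_{n-l,l}=0$; - $l$ odd, $n$ even: $a_{n-l,l}=\frac{\alpha(\min(\frac{l-1}2,\frac{n-l-1}2),n)}{2\min(l,n-l)}\Bigl(\sum_{i=0}^{(l-1)/2}\frac{c_{n-2i,2i}}{\alpha(i,n)}-\sum_{j=(l-1)/2+1}^{n/2}\frac{c_{n-2j,2j}}{\alpha(j,n)}\Bigr)$;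 - $l,n$ odd: $a_{n-l,l}=\sum_{i=0}^{(l-1)/2}\frac{c_{n-2i,2i}}{l}\prod_{j=i}^{(l-3)/2}\frac{n-2j-1}{2j+1}$; - $l$ even, $n$ odd: $a_{n-l,l}=-\sum_{i=0}^{(n-l-1)/2}\frac{c_{2i,n-2i}}{n-l}\prod_{j=i}^{(n-l-3)/2}\frac{n-2j-1}{2j+1}$. Finally $s_k(P,Q)=\frac12\sum_{i=0}^{k+1}\frac{c_{2k+2-2i,2i}}{\alpha(i,2k+2)}$. Over $\mathbb{Q}$, $s_k(P,Q)$ is given by a polynomial $s_{k,\mathbb{Q}}\in\mathbb{Q}[p_{ij},q_{ij}]$, the $k$-th focal polynomial; $\delta_k$ is the smallest positive integer with $\delta_ks_{k,\mathbb{Q}}\in\mathbb{Z}[p_{ij},q_{ij}]$. *)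

(* Defs.v *)
From HB Require Import structures.
From mathcomp Require Import all_boot all_order all_algebra.
From mathcomp Require Import mpoly.

Set Implicit Arguments.
Unset Strict Implicit.
Unset Printing Implicit Defensive.

Import Order.TTheory GRing.Theory Num.Theory.
Local Open Scope ring_scope.

(* The exponent vector of x^i y^j z^(d-i-j); only meaningful if i + j <= d. *)
Definition xyz_exp (d i j : nat) : 'X_{1..3} :=
  [multinom [tuple i; j; (d - i - j)%N]].

(* A form P dx + Q dy of degree d over K is a pair of homogeneous polynomials
   P, Q of degree d in x, y, z; form_coef d P i j is p_ij (resp. q_ij for Q). *)
Definition form_coef (K : nzRingType) (d : nat) (P : {mpoly K[3]})
    (i j : nat) : K :=
  if (i + j <= d)%N then P@_(xyz_exp d i j) else 0.

Section Frommer.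

(* Divisions are ring inverses, so the algorithm is meaningful when every
   divisor occurring in it is a unit of K. *)
Variable K : comUnitRingType.

Definition alpha (i n : nat) : K :=
  \prod_(1 <= h < i.+1) ((n%:R - (h.*2 - 1)%:R) / (h.*2 - 1)%:R).

Definition ext0 (a : nat -> nat -> K) (u v : int) : K :=
  match u, v with
  | Posz i, Posz j => a i j
  | _, _ => 0
  end.

Variables p q : nat -> nat -> K.

Definition frommer_c (a : nat -> nat -> K) (l m : nat) : K :=
  let n := (l + m)%N in
  \sum_(i < n.+1) \sum_(j < n.+1 | (2 <= i + j <= n)%N)
    (- ((m%:Z - j%:Z + 1)%:~R * p i j
          * ext0 a (l%:Z - i%:Z) (m%:Z - j%:Z + 1))
     + (l%:Z - i%:Z + 1)%:~R * q i j
          * ext0 a (l%:Z - i%:Z + 1) (m%:Z - j%:Z)).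

(* The coefficient a_(n-l,l), from the values c_(i,j) with i + j = n. *)
Definition frommer_a_step (c : nat -> nat -> K) (n l : nat) : K :=
  if ~~ odd n then
    if ~~ odd l then
      if (l < n)%N then
        - \sum_(1 <= i < (n - l)./2.+1)
            c (i.*2 - 1)%N (n - (i.*2 - 1))%N / (n - l)%:R
            * \prod_(i <= j < (n - l)./2) ((n - j.*2)%:R / (j.*2)%:R)
      else 0
    else
      alpha (minn (l - 1)./2 (n - l - 1)./2) n / (2 * minn l (n - l))%:R
      * (\sum_(0 <= i < (l - 1)./2.+1) c (n - i.*2)%N i.*2 / alpha i n
         - \sum_((l - 1)./2.+1 <= j < n./2.+1) c (n - j.*2)%N j.*2 / alpha j n)
  else
    if odd l then
      \sum_(0 <= i < (l - 1)./2.+1)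
        c (n - i.*2)%N i.*2 / l%:R
        * \prod_(i <= j < (l - 1)./2) ((n - j.*2 - 1)%:R / (j.*2 + 1)%:R)
    else
      - \sum_(0 <= i < (n - l - 1)./2.+1)
          c i.*2 (n - i.*2)%N / (n - l)%:R
          * \prod_(i <= j < (n - l - 1)./2)
              ((n - j.*2 - 1)%:R / (j.*2 + 1)%:R).

Definition frommer_a_init (i j : nat) : K :=
  if ((i, j) == (2, 0)%N) || ((i, j) == (0, 2)%N) then 1 else 0.

(* The table of the a_(i,j) after the rounds n = 3, ..., m + 2; entries with
   i + j > m + 2 are not computed yet and are 0. *)
Fixpoint frommer_a (m : nat) : nat -> nat -> K :=
  if m is m'.+1 then
    let a := frommer_a m' in
    let n := m'.+3 in
    fun i j =>
      if (i + j == n)%N then frommer_a_step (frommer_c a) n j else a i j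
  else frommer_a_init.

Definition frommer_s (k : nat) : K :=
  let c := frommer_c (frommer_a k.*2) in
  2%:R^-1 * \sum_(0 <= i < k.+2)
              c (k.*2 + 2 - i.*2)%N i.*2 / alpha i (k.*2 + 2).

End Frommer.

Definition focal_value (K : comUnitRingType) (d k : nat)
    (P Q : {mpoly K[3]}) : K :=
  frommer_s (form_coef d P) (form_coef d Q) k.

(* The indeterminates p_ij (inl) and q_ij (inr), i + j <= d. *)
Definition coef_index (d : nat) : finType :=
  {ij : 'I_d.+1 * 'I_d.+1 | (ij.1 + ij.2 <= d)%N}.

Definition nvars (d : nat) : nat := #|{: coef_index d + coef_index d}|.

Definition generic_P (d : nat) : {mpoly {mpoly rat[nvars d]}[3]} :=
  \sum_(c : coef_index d)
    'X_(enum_rank (inl c : coef_index d + coef_index d))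
      *: 'X_[xyz_exp d (val c).1 (val c).2].

Definition generic_Q (d : nat) : {mpoly {mpoly rat[nvars d]}[3]} :=
  \sum_(c : coef_index d)
    'X_(enum_rank (inr c : coef_index d + coef_index d))
      *: 'X_[xyz_exp d (val c).1 (val c).2].

(* The algorithm run on the generic form of degree d; its divisors are nonzero
   rational constants, hence units of the polynomial ring. *)
Definition focal_poly (d k : nat) : {mpoly rat[nvars d]} :=
  focal_value d k (generic_P d) (generic_Q d).

Definition is_common_denom (n : nat) (s : {mpoly rat[n]}) (delta : nat) : bool :=
  (0 < delta)%N && (delta%:R *: s \is a mpolyOver n Num.int).

Lemma ex_common_denom (n : nat) (s : {mpoly rat[n]}) :
  exists delta, is_common_denom s delta.
Proof.
exists (\prod_(m <- msupp s) `|denq s@_m|)%N.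
apply/andP; split.
  by apply: prodn_gt0 => m; rewrite absz_gt0 denq_eq0.
apply/mpolyOverP => m; rewrite mcoeffZ.
have [ms|/memN_msupp_eq0 ->] := boolP (m \in msupp s); last first.
  by rewrite mulr0 rpred0.
rewrite (perm_big _ (perm_to_rem ms)) /= big_cons natrM mulrAC mulrC.
apply: rpredM; first exact: rpred_nat.
rewrite natr_absz (ger0_norm (ltW (denq_gt0 _))) mulrC -numqE.
exact: intr_int.
Qed.

Definition smallest_common_denom (n : nat) (s : {mpoly rat[n]}) : nat :=
  ex_minn (ex_common_denom s).

Definition delta (d k : nat) : nat := smallest_common_denom (focal_poly d k).

Definition intr_mpoly (R : nzRingType) (P : {mpoly int[3]}) : {mpoly R[3]} :=
  map_mpoly (intr : int -> R) P.

(* Main.v *)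
Require Import Defs.
From HB Require Import structures.
From mathcomp Require Import all_boot all_order all_algebra.
From mathcomp Require Import mpoly.
From mathcomp Require Import zify.

Set Implicit Arguments.
Unset Strict Implicit.
Unset Printing Implicit Defensive.

Import Order.TTheory GRing.Theory Num.Theory.
Local Open Scope ring_scope.

(** Every number by which the algorithm divides in computing the k-th focal
    value is a product of integers between 1 and 2k+2 and of inverses of such
    integers.  So the algorithm makes sense over every ring in which these
    integers are invertible, and it only uses the operations of the subring
    generated by the coefficients and those inverses.

    This is expressed by a parametricity statement, [rel_frommer_s]: let a
    relation between two rings in which 1, ..., 2k+2 are invertible contain
    (1, 1) and the pairs (1/m, 1/m) for 0 < m <= 2k+2, and be stable under
    subtraction and multiplication; then it relates the two focal values as
    soon as it relates the coefficients.

    It is applied to the relation [frac_rel v] between a polynomial x over the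
    rationals and an element y of a ring L: some natural number N, invertible
    in L, turns x into an integral polynomial g, and N y is the value of g at
    the integral point v.  When 1, ..., 2k+2 are invertible in L, it relates
    the focal polynomial s to the focal value of P dx + Q dy over L, where v
    lists the coefficients of P and Q ([frac_rel_focal]).  Two consequences
    follow, with delta the smallest common denominator of s.
    - delta divides N, because the integers that clear the denominators of s
      form an ideal of Z; hence delta is invertible in L
      ([frac_rel_denom_unit]).
    - If h is the integral polynomial delta s, comparing N h = delta g at v
      shows that delta times the focal value over L is the image of the integer
      h(v) ([frac_rel_clear_denom]).

    For L the field of rationals, the second point says that delta times the
    rational focal value is the integer h(v).  For L = F of characteristic
    p > 2k+2, it says that h(v) mod p is delta times the focal value over F,
    and delta is nonzero in F by the first point. *)

(** * Parametricity of the algorithm *)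

(** A logical relation for the ring operations and for the inverses of the
    integers 1, ..., M. Stability under all inverses would be too much to ask:
    a rational number may be nonzero and reduce to 0. *)
Record ring_rel (K L : comUnitRingType) (M : nat) (R : K -> L -> Prop) : Prop :=
  RingRel {
    rel1 : R 1 1;
    relB : forall x y x' y', R x y -> R x' y' -> R (x - x') (y - y');
    relM : forall x y x' y', R x y -> R x' y' -> R (x * x') (y * y');
    relVn : forall m, (0 < m <= M)%N -> R m%:R^-1 m%:R^-1;
    rel_unitl : forall m, (0 < m <= M)%N -> (m%:R : K) \is a GRing.unit;
    rel_unitr : forall m, (0 < m <= M)%N -> (m%:R : L) \is a GRing.unit }.

(** The bound on [i] keeps the numerators n - (2h-1) of the factors positive,
    hence among the integers assumed invertible: the inverse of [alpha] is again
    built from integers and inverses of integers at most [n]. *)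
Lemma alphaV (K : comUnitRingType) (i n : nat) :
  (forall m, (0 < m <= n)%N -> (m%:R : K) \is a GRing.unit) ->
  (i.*2 <= n)%N ->
  (alpha K i n)^-1
    = \prod_(1 <= h < i.+1) ((h.*2 - 1)%:R / (n - (h.*2 - 1))%:R).
Proof.
move=> nU le_in; rewrite /alpha big_nat_cond [RHS]big_nat_cond -prodrV.
  apply: eq_bigr => h /andP[/andP[h1 hi] _].
  rewrite -natrB ?invrM ?unitrV ?invrK //.
  - by apply: nU; lia.
  - by apply: nU; lia.
  - by lia.
move=> h /andP[/andP[h1 hi] _]; rewrite -natrB; last by lia.
by rewrite unitrM unitrV !nU //; lia.
Qed.

Section Parametricity.

Variables (K L : comUnitRingType) (M : nat) (R : K -> L -> Prop).

Lemma rel0 : ring_rel M R -> R 0 0.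
Proof. by move=> RR; have := relB RR (rel1 RR) (rel1 RR); rewrite !subrr. Qed.

Lemma relN x y : ring_rel M R -> R x y -> R (- x) (- y).
Proof.
move=> RR Rxy; rewrite -[- x]sub0r -[- y]sub0r.
by apply: (relB RR) => //; exact: rel0.
Qed.

Lemma relD x y x' y' : ring_rel M R -> R x y -> R x' y' -> R (x + x') (y + y').
Proof.
move=> RR Rxy Rxy'; rewrite -[x']opprK -[y']opprK.
by apply: (relB RR) => //; exact: relN.
Qed.

Lemma rel_nat n : ring_rel M R -> R n%:R n%:R.
Proof.
move=> RR; elim: n => [|n IHn]; first by rewrite mulr0n; exact: rel0.
by rewrite !mulrS; apply: relD => //; exact: rel1 RR.
Qed.

Lemma rel_int (z : int) : ring_rel M R -> R z%:~R z%:~R.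
Proof.
move=> RR; case: z => n; first exact: rel_nat.
by rewrite NegzE !mulrNz; apply: relN => //; exact: rel_nat.
Qed.

Lemma rel_div x y m :
  ring_rel M R -> (0 < m <= M)%N -> R x y -> R (x / m%:R) (y / m%:R).
Proof. by move=> RR hm Rxy; apply: (relM RR) => //; exact: (relVn RR). Qed.

Lemma rel_sum (I : Type) (r : seq I) (P : pred I) (F : I -> K) (G : I -> L) :
  ring_rel M R -> (forall i, P i -> R (F i) (G i)) ->
  R (\sum_(i <- r | P i) F i) (\sum_(i <- r | P i) G i).
Proof.
move=> RR; apply: big_ind2; first exact: rel0.
by move=> x y x' y'; exact: relD.
Qed.

Lemma rel_sum_nat m n (F : nat -> K) (G : nat -> L) :
  ring_rel M R -> (forall i, (m <= i < n)%N -> R (F i) (G i)) ->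
  R (\sum_(m <= i < n) F i) (\sum_(m <= i < n) G i).
Proof.
move=> RR FG; rewrite big_nat_cond [X in R _ X]big_nat_cond.
by apply: rel_sum => // i /andP[/FG].
Qed.

Lemma rel_prod_nat m n (F : nat -> K) (G : nat -> L) :
  ring_rel M R -> (forall i, (m <= i < n)%N -> R (F i) (G i)) ->
  R (\prod_(m <= i < n) F i) (\prod_(m <= i < n) G i).
Proof.
move=> RR FG; rewrite big_nat_cond [X in R _ X]big_nat_cond.
apply: (big_ind2 R); [exact: rel1 RR|exact: relM RR|].
by move=> i /andP[/FG].
Qed.

Lemma rel_alpha i n :
  ring_rel M R -> (i.*2 <= n <= M)%N -> R (alpha K i n) (alpha L i n).
Proof.
move=> RR hin; apply: rel_prod_nat => // h hh.
by apply: rel_div; [exact: RR|lia|apply: (relB RR); exact: rel_nat].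
Qed.

Lemma rel_alphaV i n :
  ring_rel M R -> (i.*2 <= n <= M)%N -> R (alpha K i n)^-1 (alpha L i n)^-1.
Proof.
move=> RR hin; rewrite !alphaV; last first.
- by lia.
- by move=> m hm; apply: (rel_unitl RR); lia.
- by lia.
- by move=> m hm; apply: (rel_unitr RR); lia.
apply: rel_prod_nat => // h hh.
by apply: rel_div; [exact: RR|lia|exact: rel_nat].
Qed.

Lemma rel_ext0 a b u v :
  ring_rel M R -> (forall i j, R (a i j) (b i j)) ->
  R (ext0 a u v) (ext0 b u v).
Proof. by move=> RR ab; case: u v => u [] v //=; exact: rel0. Qed.

Lemma rel_frommer_c p q p' q' a b l m :
  ring_rel M R ->
  (forall i j, R (p i j) (p' i j)) -> (forall i j, R (q i j) (q' i j)) ->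
  (forall i j, R (a i j) (b i j)) ->
  R (frommer_c p q a l m) (frommer_c p' q' b l m).
Proof.
move=> RR pp qq ab; apply: rel_sum => // i _; apply: rel_sum => // j _.
apply: relD; [exact: RR|apply: relN => //|];
  by apply: (relM RR); [apply: (relM RR) => //; exact: rel_int|exact: rel_ext0].
Qed.

(** In each of the five cases, the parity of [n] and [l] and the ranges of the
    sums keep all divisors between 1 and [n]; in the case of [l] odd and [n]
    even, parity forces l < n, so that min(l, n-l) is positive. *)
Lemma rel_frommer_a_step c c' n l :
  ring_rel M R -> (l <= n <= M)%N -> (forall i j, R (c i j) (c' i j)) ->
  R (frommer_a_step c n l) (frommer_a_step c' n l).
Proof.
move=> RR hln cc; rewrite /frommer_a_step.
case: ifPn => on; case: ifPn => ol.
- case: ifPn => hlt; last exact: rel0.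
  apply: relN => //; apply: rel_sum_nat => // i hi.
  apply: (relM RR); first by apply: rel_div; [exact: RR|lia|].
  apply: rel_prod_nat => // j hj.
  by apply: rel_div; [exact: RR|lia|exact: rel_nat].
- apply: (relM RR).
    by apply: rel_div; [exact: RR|lia|apply: rel_alpha => //; lia].
  by apply: (relB RR); apply: rel_sum_nat => // i hi;
     apply: (relM RR) => //; apply: rel_alphaV => //; lia.
- apply: rel_sum_nat => // i hi.
  apply: (relM RR); first by apply: rel_div; [exact: RR|lia|].
  apply: rel_prod_nat => // j hj.
  by apply: rel_div; [exact: RR|lia|exact: rel_nat].
- apply: relN => //; apply: rel_sum_nat => // i hi.
  apply: (relM RR); first by apply: rel_div; [exact: RR|lia|].
  apply: rel_prod_nat => // j hj.
  by apply: rel_div; [exact: RR|lia|exact: rel_nat].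
Qed.

Lemma rel_frommer_a p q p' q' m i j :
  ring_rel M R ->
  (forall i j, R (p i j) (p' i j)) -> (forall i j, R (q i j) (q' i j)) ->
  (m.+2 <= M)%N ->
  R (frommer_a p q m i j) (frommer_a p' q' m i j).
Proof.
move=> RR pp qq; elim: m i j => [|m IHm] i j hm /=.
  by rewrite /frommer_a_init; case: ifP => _; [exact: rel1 RR|exact: rel0].
case: ifP => [/eqP hij|_]; last by apply: IHm; lia.
apply: rel_frommer_a_step => //; first by lia.
by move=> i' j'; apply: rel_frommer_c => // i2 j2; apply: IHm; lia.
Qed.

Lemma rel_frommer_s p q p' q' k :
  ring_rel M R ->
  (forall i j, R (p i j) (p' i j)) -> (forall i j, R (q i j) (q' i j)) ->
  (2 * k + 2 <= M)%N ->
  R (frommer_s p q k) (frommer_s p' q' k).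
Proof.
move=> RR pp qq hk; apply: (relM RR); first by apply: (relVn RR); lia.
apply: rel_sum_nat => // i hi; apply: (relM RR).
  by apply: rel_frommer_c => // i' j'; apply: rel_frommer_a => //; lia.
by apply: rel_alphaV => //; lia.
Qed.

End Parametricity.

(** * Polynomials with denominators invertible in a ring *)

Section IntegralFractions.

Variable n : nat.
Implicit Types (x : {mpoly rat[n]}) (g : {mpoly int[n]}).

Definition int_mpoly g : {mpoly rat[n]} := map_mpoly (intr : int -> rat) g.

(** For L a field of characteristic p, the polynomials in the domain of this
    relation are those over the localization of Z at p, and the relation is the
    graph of reduction modulo p followed by evaluation at [v]. For L the field
    of rationals, it is the graph of evaluation at [v]. *)
Definition frac_rel (L : comUnitRingType) (v : 'I_n -> int) x (y : L) : Prop :=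
  exists N g, [/\ (N%:R : L) \is a GRing.unit,
    N%:R * x = int_mpoly g & N%:R * y = (g.@[v])%:~R].

Lemma int_mpoly_inj : injective int_mpoly.
Proof.
move=> g h /mpolyP gh; apply/mpolyP => m; have := gh m.
by rewrite !mcoeff_map_mpoly; exact: intr_inj.
Qed.

Lemma int_mpolyP x : x \is a mpolyOver n Num.int -> exists g, x = int_mpoly g.
Proof.
move=> /mpolyOverP xint; exists (\sum_(m <- msupp x) numq x@_m *: 'X_[m]).
rewrite {1}[x]mpolyE /int_mpoly raddf_sum /=; apply: eq_bigr => m _.
by rewrite map_mpolyZ map_mpolyX /= numqK.
Qed.

Lemma ratn_mpoly_unit m : (0 < m)%N -> (m%:R : {mpoly rat[n]}) \is a GRing.unit.
Proof.
move=> m0; rewrite -mpolyC_nat; apply: rmorph_unit.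
by rewrite unitfE pnatr_eq0 -lt0n.
Qed.

Lemma frac_ring_rel (L : comUnitRingType) (v : 'I_n -> int) (M : nat) :
  (forall m, (0 < m <= M)%N -> (m%:R : L) \is a GRing.unit) ->
  ring_rel M (@frac_rel L v).
Proof.
move=> LU; split=> //.
- by exists 1%N, 1; rewrite unitr1 /int_mpoly !rmorph1 !mulr1.
- move=> x y x' y' [N [g [NU Nx Ny]]] [N' [g' [NU' Nx' Ny']]].
  exists (N * N')%N, (N'%:R * g - N%:R * g').
  rewrite /int_mpoly !natrM unitrM NU NU' !rmorphB !rmorphM /= !rmorph_nat.
  rewrite -!/(int_mpoly _) -Nx -Nx' -Ny -Ny'.
  by split=> //; rewrite mulrBr !mulrA; congr (_ - _); rewrite [N%:R * _]mulrC.
- move=> x y x' y' [N [g [NU Nx Ny]]] [N' [g' [NU' Nx' Ny']]].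
  exists (N * N')%N, (g * g').
  rewrite /int_mpoly !natrM unitrM NU NU' !rmorphM /= -!/(int_mpoly _).
  by rewrite -Nx -Nx' -Ny -Ny' ![_ * x * _]mulrACA ![_ * y * _]mulrACA.
- move=> m hm; exists m, 1; rewrite /int_mpoly !rmorph1 LU //.
  by rewrite !mulrV ?LU // ratn_mpoly_unit //; case/andP: hm.
- by move=> m /andP[m0 _]; exact: ratn_mpoly_unit.
Qed.

(** The integers that clear the denominators of [s] form an ideal of Z, so the
    remainder modulo the smallest one would be a smaller one. *)
Lemma smallest_common_denom_dvd (s : {mpoly rat[n]}) (N : nat) :
  is_common_denom s N -> (smallest_common_denom s %| N)%N.
Proof.
rewrite /smallest_common_denom; case: ex_minnP => m /andP[m0 ms] mmin.
move=> /andP[_ Ns].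
case: (posnP (N %% m)) => [/eqP //|r0].
suff /mmin : is_common_denom s (N %% m) by rewrite leqNgt ltn_mod m0.
rewrite /is_common_denom r0 /=.
have -> : ((N %% m)%:R : rat) = N%:R - (N %/ m)%:R * m%:R.
  by rewrite -natrM {2}(divn_eq N m) natrD addrC addKr.
apply/mpolyOverP => u; move/mpolyOverP/(_ u): Ns; move/mpolyOverP/(_ u): ms.
rewrite !mcoeffZ mulrBl -mulrA => ms Ns.
by rewrite rpredB // rpredM // rpred_nat.
Qed.

Lemma smallest_common_denom_int (s : {mpoly rat[n]}) :
  exists h, (smallest_common_denom s)%:R * s = int_mpoly h.
Proof.
rewrite /smallest_common_denom; case: ex_minnP => m /andP[m0 ms] _.
have [h hE] := int_mpolyP ms; exists h.
by rewrite -hE -mul_mpolyC mpolyC_nat.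
Qed.

(** The denominator D and the denominator N given by the relation lead to two
    integral multiples h = D x and g = N x with N h = D g. This identity holds
    over the integers, so it can be evaluated at [v] in L, where N cancels. *)
Lemma frac_rel_clear_denom (L : comUnitRingType) v x (y : L) h :
  frac_rel v x y -> (smallest_common_denom x)%:R * x = int_mpoly h ->
  ((smallest_common_denom x)%:R : L) * y = (h.@[v])%:~R.
Proof.
move=> [N [g [NU Nx Ny]]] hE; set D := smallest_common_denom x in hE *.
have NhDg : N%:R * h = D%:R * g.
  apply: int_mpoly_inj; rewrite /int_mpoly !rmorphM /= !rmorph_nat.
  by rewrite -!/(int_mpoly _) -hE -Nx mulrCA.
apply: (mulrI NU); rewrite mulrCA Ny.
have := congr1 (fun f => (f.@[v])%:~R : L) NhDg.
by rewrite !rmorphM /= !rmorph_nat => <-.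
Qed.

(** The smallest common denominator divides every other one, in particular the
    invertible one that the relation provides. *)
Lemma frac_rel_denom_unit (L : comUnitRingType) v x (y : L) :
  frac_rel v x y -> ((smallest_common_denom x)%:R : L) \is a GRing.unit.
Proof.
move=> [N [g [NU Nx _]]].
have N0 : (0 < N)%N by case: (posnP N) NU => // ->; rewrite unitr0.
suff /smallest_common_denom_dvd /dvdnP[q Nq] : is_common_denom x N.
  by move: NU; rewrite Nq natrM unitrM => /andP[].
rewrite /is_common_denom N0 -mul_mpolyC mpolyC_nat Nx.
by apply/mpolyOverP => m; rewrite mcoeff_map_mpoly; exact: intr_int.
Qed.

End IntegralFractions.

(** * The generic form and its specializations *)

Lemma xyz_exp_inj d i j i' j' :
  xyz_exp d i j = xyz_exp d i' j' -> i = i' /\ j = j'.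
Proof.
move=> E; split.
  by have := congr1 (fun m : 'X_{1..3} => m 0%R) E; rewrite /xyz_exp !multinomE.
by have := congr1 (fun m : 'X_{1..3} => m 1%R) E; rewrite /xyz_exp !multinomE.
Qed.

Lemma mcoeff_generic (A : nzRingType) (d : nat) (X : coef_index d -> A)
    (c : coef_index d) :
  (\sum_(e : coef_index d) X e *: 'X_[xyz_exp d (val e).1 (val e).2])
    @_(xyz_exp d (val c).1 (val c).2) = X c.
Proof.
rewrite raddf_sum (bigD1 c) //= mcoeffZ mcoeffX eqxx mulr1.
rewrite big1 ?addr0 // => e ec.
rewrite mcoeffZ mcoeffX.
case: eqP => [/xyz_exp_inj[e1 e2]|_]; last by rewrite mulr0.
case/eqP: ec; apply/val_inj.
rewrite [LHS]surjective_pairing [RHS]surjective_pairing.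
by rewrite (ord_inj e1) (ord_inj e2).
Qed.

Definition form_point (d : nat) (P Q : {mpoly int[3]}) (i : 'I_(nvars d)) :
    int :=
  match enum_val i with
  | inl c => P@_(xyz_exp d (val c).1 (val c).2)
  | inr c => Q@_(xyz_exp d (val c).1 (val c).2)
  end.

Lemma frac_rel_form_coef (L : comUnitRingType) (d : nat)
    (v : 'I_(nvars d) -> int)
    (X : coef_index d -> 'I_(nvars d)) (P : {mpoly int[3]}) (i j : nat) :
  (forall c, v (X c) = P@_(xyz_exp d (val c).1 (val c).2)) ->
  frac_rel v
    (form_coef d (\sum_(c : coef_index d)
       'X_(X c) *: 'X_[xyz_exp d (val c).1 (val c).2]) i j)
    (form_coef d (intr_mpoly L P) i j).
Proof.
move=> vX; rewrite /form_coef; case: ifP => hij; last first.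
  by apply: (@rel0 _ _ 0%N); apply: frac_ring_rel; case.
have hi : (i < d.+1)%N by lia.
have hj : (j < d.+1)%N by lia.
pose c : coef_index d := Sub (Ordinal hi, Ordinal hj) hij.
exists 1%N, 'X_(X c); rewrite unitr1 !mul1r; split=> //.
  by rewrite (mcoeff_generic (fun e => 'X_(X e)) c) /int_mpoly map_mpolyX.
by rewrite mevalXU vX mcoeff_map_mpoly.
Qed.

Lemma frac_rel_focal (L : comUnitRingType) (d k : nat) (P Q : {mpoly int[3]}) :
  (forall m, (0 < m <= 2 * k + 2)%N -> (m%:R : L) \is a GRing.unit) ->
  frac_rel (form_point P Q) (focal_poly d k)
    (focal_value d k (intr_mpoly L P) (intr_mpoly L Q)).
Proof.
move=> LU; apply: (rel_frommer_s (frac_ring_rel _ LU)) => // i j.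
  by apply: frac_rel_form_coef => c; rewrite /form_point enum_rankK.
by apply: frac_rel_form_coef => c; rewrite /form_point enum_rankK.
Qed.

Theorem corollaryA5 (k : nat) (hk : (1 <= k)%N)
    (F : finFieldType) (p : nat) (hF : p \in [pchar F])
    (hp : (2 * k + 2 < p)%N)
    (d : nat) (P Q : {mpoly int[3]})
    (hP : P \is d.-homog) (hQ : Q \is d.-homog) :
  exists2 z : int,
    (delta d k)%:R * focal_value d k (intr_mpoly rat P) (intr_mpoly rat Q)
      = z%:~R
    & focal_value d k (intr_mpoly F P) (intr_mpoly F Q) = 0
        <-> z%:~R = 0 :> F.
Proof.
have ratU m : (0 < m <= 2 * k + 2)%N -> (m%:R : rat) \is a GRing.unit.
  by case/andP=> m0 _; rewrite unitfE pnatr_eq0 -lt0n.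
have FU m : (0 < m <= 2 * k + 2)%N -> (m%:R : F) \is a GRing.unit.
  case/andP=> m0 mk; rewrite unitfE -(dvdn_pcharf hF) gtnNdvd //.
  exact: leq_ltn_trans mk hp.
have [h hE] := smallest_common_denom_int (focal_poly d k).
have focal_rat := frac_rel_focal d P Q ratU.
have focal_F := frac_rel_focal d P Q FU.
exists h.@[form_point P Q]; first exact: (frac_rel_clear_denom focal_rat hE).
have deltaU := frac_rel_denom_unit focal_F.
rewrite -(frac_rel_clear_denom focal_F hE) //.
split=> [->|]; first by rewrite mulr0.
move=> /eqP; rewrite mulf_eq0 => /orP[|/eqP //].
by move: deltaU; rewrite unitfE => /negPf ->.
Qed.
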